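(* Let $C\subseteq\mathbb{F}_2^n$ be a binary linear $[n,k,d]$ code with $\mathbf{1}_n\in C$, whose dual $C^\perp$ has minimum distance $d^\perp$, and let $t$ be a positive integer such that $$d^\perp-t=\#\{u \mid C_u\neq\emptyset,\ 0<u\le n-t\}.$$ (1) If $d^\perp-t=1$, then $(d^\perp,t)=(2,1)$ or $(4,3)$. Moreover, $\delta(C)=s(C)=\delta(C^\perp)=s(C^\perp)$ and this common value is $1$ or $3$. (2) If $d^\perp-t=2$, then $(d^\perp,t)=(4,2)$. (3) If $d^\perp-t=3$, then $(d^\perp,t)\in\{(4,1),(6,3),(8,5)\}$.
   Context: $\mathbf{1}_n$ is the all-ones vector. $C^\perp=\{y\in\mathbb{F}_2^n : \sum_i x_iy_i=0 \text{ for all } x\in C\}$, and $d^\perp$ is the minimum weight of a nonzero vector of $C^\perp$ (assumed $C^\perp\neq 0$). For $u$, $C_u=\{c\in C : \mathrm{wt}(c)=u\}$, where $\mathrm{wt}$ is the Hamming weight. A $t$-$(v,k,\lambda)$ design is a pair $(X,\mathcal{B})$ with $|X|=v$ and $\mathcal{B}$ a collection of $k$-subsets of $X$ (blocks) such that every $t$-subset of $X$ is contained in exactly $\lambda$ blocks. The support of $x\in\mathbb{F}_2^n$ is $\mathrm{supp}(x)=\{i : x_i\neq 0\}$. The support design $D_w$ of $C$ for weight $w$ has point set $\{1,\dots,n\}$ and blocks the supports of the codewords of $C$ of weight $w$; similarly for $C^\perp$. $\delta(C)=\max\{t\in\mathbb{N} \mid D_w \text{ is a } t\text{-design for every } w\}$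 and $s(C)=\max\{t\in\mathbb{N}\mid D_w \text{ is a } t\text{-design for some } w\}$, where $w$ ranges over the weights with $0<w<n$ occurring in $C$; $\delta(C^\perp), s(C^\perp)$ are defined in the same way for $C^\perp$. *)

(* Defs.v *)
From HB Require Import structures.
From mathcomp Require Import all_boot all_order all_algebra.
Set Implicit Arguments. Unset Strict Implicit. Unset Printing Implicit Defensive.
Import GRing.Theory.
Local Open Scope ring_scope.

Notation word n := 'rV['F_2]_n.

Definition ones (n : nat) : word n := \row_(i < n) 1.

Definition supp (n : nat) (x : word n) : {set 'I_n} := [set i | x 0 i != 0].
Definition wt (n : nat) (x : word n) : nat := #|supp x|.

Definition cwords (n : nat) (C : {vspace word n}) : {set word n} :=
  [set x : word n | x \in C].

Definition dual (n : nat) (S : {set word n}) : {set word n} :=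
  [set y : word n | [forall x in S, \sum_(i < n) x 0 i * y 0 i == 0]].

(* minimum weight of a nonzero vector of S (meaningful when S <> {0}) *)
Definition minwt (n : nat) (S : {set word n}) : nat :=
  \big[minn/n.+1]_(x in S | x != 0) wt x.

Definition occurs (n : nat) (S : {set word n}) (w : nat) : bool :=
  [exists x in S, wt x == w].

Definition supp_design (n : nat) (S : {set word n}) (w : nat) : {set {set 'I_n}} :=
  [set supp x | x in [set x in S | wt x == w]].

(* (points 'I_n, blocks B of size k) is a t-(n,k,lambda) design for some lambda,
   with the standard requirement t <= k *)
Definition is_tdesign (n : nat) (t k : nat) (B : {set {set 'I_n}}) : Prop :=
  (t <= k)%N /\ exists lambda : nat,
    forall T : {set 'I_n}, #|T| = t -> #|[set b in B | T \subset b]| = lambda.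

Definition delta_prop (n : nat) (S : {set word n}) (t : nat) : Prop :=
  forall w : nat, (0 < w < n)%N -> occurs S w -> is_tdesign t w (supp_design S w).

Definition s_prop (n : nat) (S : {set word n}) (t : nat) : Prop :=
  exists w : nat, [/\ (0 < w < n)%N, occurs S w & is_tdesign t w (supp_design S w)].

Definition is_max_nat (P : nat -> Prop) (m : nat) : Prop :=
  P m /\ forall t, P t -> (t <= m)%N.

Definition delta_is (n : nat) (S : {set word n}) (m : nat) := is_max_nat (delta_prop S) m.
Definition s_is (n : nat) (S : {set word n}) (m : nat) := is_max_nat (s_prop S) m.

Definition nweights_upto (n : nat) (S : {set word n}) (t : nat) : nat :=
  #|[set u : 'I_n.+1 | (0 < u <= n - t)%N && occurs S u]|.

(* Main.v *)
Require Import Defs.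
From HB Require Import structures.
From mathcomp Require Import all_boot all_order all_algebra.
From mathcomp Require Import ring zify.

Set Implicit Arguments.
Unset Strict Implicit.
Unset Printing Implicit Defensive.
Import Order.TTheory GRing.Theory Num.Theory.

(** Words over F_2 are identified with their supports, so that a code is a
    family of sets closed under symmetric difference.  The words of C vanishing
    on a t-set T form a code with at most s = d^perp - t nonzero weights; hence
    its s-th binomial moment is determined by the lower ones, and every t-set
    lies in the same positive number of supports of dual words of weight d^perp
    (Assmus-Mattson).  Two such blocks sharing t-1 points have a symmetric
    difference of weight at least d^perp, so 2(t-1) <= d^perp; as d^perp is even,
    this leaves the listed parameters and (6,4).

    For (6,4), the nontrivial weights are u and n-u, and the second and fourth
    power moments give |C| = n^2-n+2 and (n-2u)^2 = n-2.  With m = |n-2u| the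
    power of two |C| equals (m^2+m+2)(m^2-m+2), which forces n <= 6 = d^perp.

    For s = 1 the only nontrivial weight is n/2, and the MacWilliams identity
    gives in closed form the enumerator of the dual words containing a set T.
    It depends only on |T| when |T| < d^perp.  When |T| = d^perp, the values for
    T a dual word and T not a dual word differ by
    X^d^perp (1-X^2)^(n/2-d^perp), in which the coefficient at every possible
    dual weight is nonzero. *)

(** * Set codes and the MacWilliams identity *)

Definition symdiff (I : finType) (A B : {set I}) : {set I} :=
  (A :\: B) :|: (B :\: A).

Definition set_code (I : finType) (C : {set {set I}}) : Prop :=
  set0 \in C /\ {in C &, forall A B, symdiff A B \in C}.

(** Over F_2 an inner product is the parity of the intersection of the supports, so this is the dual
    code. *)
Definition perp (I : finType) (C : {set {set I}}) : {set {set I}} :=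
  [set Y | [forall A in C, ~~ odd #|A :&: Y|]].

(** Only a lower bound: where it must be attained, a dual word [B0] with [#|B0| = d] is supplied
    separately. *)
Definition min_card (I : finType) (D : {set {set I}}) (d : nat) : Prop :=
  {in D, forall Y, Y != set0 -> d <= #|Y|}.

Section SymmetricDifference.
Variable I : finType.
Implicit Types A B Y : {set I}.

Lemma in_symdiff A B i : (i \in symdiff A B) = (i \in A) (+) (i \in B).
Proof. by rewrite !inE; case: (i \in A); case: (i \in B). Qed.

Lemma symdiffK A : involutive (symdiff A).
Proof. by move=> B; apply/setP=> i; rewrite !in_symdiff addKb. Qed.

Lemma symdiffT A : symdiff setT A = ~: A.
Proof. by apply/setP=> i; rewrite in_symdiff !inE. Qed.

Lemma card_symdiff A B : #|symdiff A B| + (#|A :&: B|).*2 = #|A| + #|B|.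
Proof.
have disjD : (A :\: B) :&: (B :\: A) = set0.
  by apply/setP=> i; rewrite !inE; case: (i \in A); case: (i \in B).
rewrite cardsU disjD cards0 -(cardsID B A) -(cardsID A B) (setIC B A).
by lia.
Qed.

Lemma symdiff_eq0 A B : (symdiff A B == set0) = (A == B).
Proof.
apply/eqP/eqP=> [E|->]; last by apply/setP=> i; rewrite in_symdiff addbb inE.
apply/setP=> i; have := in_symdiff A B i; rewrite E inE.
by case: (i \in A); case: (i \in B).
Qed.

Lemma odd_symdiffI A B Y :
  odd #|symdiff A B :&: Y| = odd #|A :&: Y| (+) odd #|B :&: Y|.
Proof.
have -> : symdiff A B :&: Y = symdiff (A :&: Y) (B :&: Y).
  apply/setP=> i; rewrite inE !in_symdiff !inE.
  by case: (i \in A); case: (i \in B); case: (i \in Y).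
have := card_symdiff (A :&: Y) (B :&: Y).
by move/(congr1 odd); rewrite !oddD odd_double addbF.
Qed.

Lemma perpP (C : {set {set I}}) Y :
  reflect {in C, forall A, ~~ odd #|A :&: Y|} (Y \in perp C).
Proof. by rewrite inE; apply: (iffP forall_inP). Qed.

Lemma set_code_perp (C : {set {set I}}) : set_code (perp C).
Proof.
split; first by apply/perpP=> A _; rewrite setI0 cards0.
move=> Y Z /perpP hY /perpP hZ; apply/perpP=> A AC.
by rewrite setIC odd_symdiffI !(setIC _ A) (negbTE (hY _ AC)) (negbTE (hZ _ AC)).
Qed.

End SymmetricDifference.

Lemma exists_set_between (I : finType) (A B : {set I}) m :
  A \subset B -> #|A| <= m <= #|B| ->
  exists T : {set I}, [/\ A \subset T, T \subset B & #|T| = m].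
Proof.
move=> sAB /andP[leAm]; elim: m leAm => [|m IHm].
  rewrite leqn0 => /eqP A0 _; exists A; split=> //; exact/eqP/A0.
rewrite leq_eqVlt => /orP[/eqP <- _|ltAm ltmB]; first by exists A.
have [||T [sAT sTB cT]] := IHm; first by rewrite -ltnS.
  exact: ltnW.
have /properP[_ [x xB xT]] : T \proper B.
  by rewrite properEcard sTB cT.
exists (x |: T); split; last by rewrite cardsU1 xT cT.
  exact: subset_trans sAT (subsetUr _ _).
by rewrite subUset sub1set xB.
Qed.

Section MacWilliams.
Local Open Scope ring_scope.
Variables (I : finType) (C : {set {set I}}).
Hypothesis codeC : set_code C.

(** Character orthogonality: if some [B] in [C] meets [Y] oddly, adding [B] exchanges the words with
    even and with odd intersection, so the signs cancel. *)
Lemma sum_sign (R : comNzRingType) (Y : {set I}) :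
  \sum_(A in C) (-1) ^+ #|A :&: Y| = (#|C| * (Y \in perp C))%:R :> R.
Proof.
case: perpP => [hY|nY].
  rewrite muln1 -sumr_const; apply: eq_bigr => A AC.
  by rewrite -signr_odd (negbTE (hY _ AC)).
rewrite muln0.
have [B BC oB] : exists2 B, B \in C & odd #|B :&: Y|.
  apply/exists_inP; apply: contra_notT nY; rewrite negb_exists_in => /forall_inP.
  by [].
have E : \sum_(A in C | odd #|A :&: Y|) 1 = \sum_(A in C | ~~ odd #|A :&: Y|) 1 :> R.
  rewrite (reindex_inj (inv_inj (symdiffK B))); apply: eq_bigl => A.
  rewrite odd_symdiffI oB addTb; congr (_ && _).
  apply/idP/idP=> h; last exact: codeC.2.
  by rewrite -(symdiffK B A); apply: codeC.2.
rewrite (bigID (fun A => odd #|A :&: Y|)) /=.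
rewrite (eq_bigr (fun=> - 1)); last by move=> A /andP[_ oA]; rewrite -signr_odd oA.
rewrite sumrN [X in _ + X](eq_bigr (fun=> 1)); last first.
  by move=> A /andP[_ /negbTE oA]; rewrite -signr_odd oA.
by rewrite E addNr.
Qed.

(** Expand the product over subsets [Y] and sum over [A] first. Letting [f] and [g] vary with the
    coordinate allows later choices to prescribe behaviour on a set [T]. *)
Lemma macwilliams (R : comNzRingType) (f g : I -> R) :
  \sum_(A in C) \prod_i (g i + (-1) ^+ (i \in A) * f i) =
  #|C|%:R * \sum_(Y in perp C) \prod_i (if i \in Y then f i else g i).
Proof.
transitivity (\sum_(A in C) \sum_(Y : {set I})
    (-1) ^+ #|A :&: Y| * \prod_i (if i \in Y then f i else g i) : R).
  apply: eq_bigr => A _.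
  under eq_bigr do rewrite addrC.
  rewrite bigA_distr; apply: eq_bigr => Y _.
  rewrite -prodr_const [X in _ = X * _]big_mkcond -big_split /=.
  apply: eq_bigr => i _; rewrite inE.
  by case: (i \in A); case: (i \in Y); rewrite ?mul1r ?mulN1r.
rewrite exchange_big mulr_sumr [RHS]big_mkcond; apply: eq_bigr => Y _ /=.
rewrite -mulr_suml sum_sign natrM; case: (Y \in perp C); first by rewrite mulr1.
by rewrite mulr0 mul0r.
Qed.

End MacWilliams.

(** * Binomial moments of shortened codes *)

Definition covers (I : finType) (B : {set {set I}}) (T : {set I}) : nat :=
  #|[set Y in B | T \subset Y]|.

Definition layer (I : finType) (D : {set {set I}}) (w : nat) : {set {set I}} :=
  [set Y in D | #|Y| == w].

Lemma layerP (I : finType) (D : {set {set I}}) (w : nat) (Y : {set I}) :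
  reflect (Y \in D /\ #|Y| = w) (Y \in layer D w).
Proof. by rewrite inE; apply: (iffP andP) => -[YD /eqP cY]. Qed.

Definition moment (I : finType) (C : {set {set I}}) (T : {set I}) (j : nat) : nat :=
  \sum_(A in C | [disjoint A & T]) 'C(#|A|, j).

Section Moments.
Local Open Scope ring_scope.
Variables (I : finType) (C : {set {set I}}) (d : nat).
Hypotheses (codeC : set_code C) (mind : min_card (perp C) d).
Implicit Types T J : {set I}.

(** With [f] equal to 1 on [T], -1 on [J] and 0 elsewhere, a factor on [T :|: J] is 2 if [A] has the
    prescribed value there and 0 otherwise, while dual words leaving [T :|: J] contribute
    nothing. *)
Lemma pattern_count T J : [disjoint T & J] ->
  (2 ^ (#|T| + #|J|) * #|[set A in C | [disjoint A & T] && (J \subset A)]|)%:R =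
  #|C|%:R * \sum_(Y in perp C | Y \subset T :|: J) (-1) ^+ #|Y :&: J| :> int.
Proof.
move=> dTJ.
have inTJ i : i \in T -> (i \in J) = false by move/(disjointFr dTJ).
have := macwilliams codeC (fun i => (i \in T)%:R - (i \in J)%:R) (fun=> 1 : int).
rewrite [X in _ = _ * X](_ : _ =
  \sum_(Y in perp C | Y \subset T :|: J) (-1) ^+ #|Y :&: J|); last first.
  rewrite [RHS]big_mkcondr /=; apply: eq_bigr => Y _; case: ifP => [sY|/negbT].
    rewrite -prodr_const [RHS]big_mkcond; apply: eq_bigr => i _; rewrite inE.
    have := subsetP sY i; rewrite inE; case: (i \in Y) => //= /(_ isT).
    by case iT: (i \in T); rewrite ?(inTJ _ iT) //= => ->; rewrite sub0r.
  case/subsetPn=> i iY; rewrite inE => /norP[/negbTE iT /negbTE iJ].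
  by rewrite (bigD1 i) //= iY iT iJ subrr mul0r.
move <-; rewrite natrM mulr_natr -sumr_const.
under eq_bigl do rewrite inE.
rewrite big_mkcondr /=.
apply: eq_bigr => A _; case: ifP => [/andP[dAT sJA]|/negbT].
  rewrite natrX -cardsUI (disjoint_setI0 dTJ) cards0 addn0 -prodr_const.
  rewrite big_mkcond; apply: eq_bigr => i _; rewrite inE.
  case iT: (i \in T); first by rewrite (inTJ _ iT) (disjointFl dAT iT) subr0 mulr1.
  case iJ: (i \in J); last by rewrite subrr mulr0 addr0.
  by rewrite (subsetP sJA _ iJ).
rewrite negb_and => /orP[|/subsetPn[i iJ iA]].
  rewrite -setI_eq0 => /set0Pn[i]; rewrite inE => /andP[iA iT].
  by rewrite (bigD1 i) //= iA iT (inTJ _ iT) subr0 mulr1 subrr mul0r.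
have iT : (i \in T) = false by apply: contraTF iJ => /inTJ ->.
by rewrite (bigD1 i) //= (negbTE iA) iJ iT sub0r mul1r subrr mul0r.
Qed.

(** Fewer than [d] coordinates support no nonzero dual word, so all patterns on them are equally
    frequent. *)
Lemma pattern_count_lt T J : [disjoint T & J] -> (#|T| + #|J| < d)%N ->
  (2 ^ (#|T| + #|J|) * #|[set A in C | [disjoint A & T] && (J \subset A)]| = #|C|)%N.
Proof.
move=> dTJ ltd; apply/eqP; rewrite -(eqr_nat int) pattern_count //.
rewrite (bigD1 set0) ?sub0set ?(set_code_perp C).1 //= set0I cards0 expr0.
rewrite big1 ?addr0 ?mulr1 // => Y /andP[/andP[YC sY] Y0].
have := mind YC Y0; have := subset_leq_card sY.
by rewrite cardsU (disjoint_setI0 dTJ) cards0 subn0; lia.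
Qed.

(** On [d] coordinates one further dual word is possible, [T :|: J] itself. *)
Lemma pattern_count_eq T J : (0 < d)%N -> [disjoint T & J] -> (#|T| + #|J| = d)%N ->
  (2 ^ d * #|[set A in C | [disjoint A & T] && (J \subset A)]|)%:R =
  #|C|%:R * (1 + (-1) ^+ #|J| * (T :|: J \in perp C)%:R) :> int.
Proof.
move=> d0 dTJ eqd; rewrite -[in LHS]eqd pattern_count //; congr (_ * _).
have cTJ : #|T :|: J| = d by rewrite cardsU (disjoint_setI0 dTJ) cards0 subn0.
have TJ0 : T :|: J != set0 by rewrite -card_gt0 cTJ.
have onlyTJ Y : Y \in perp C -> Y \subset T :|: J -> Y != set0 -> Y = T :|: J.
  by move=> YC sY Y0; apply/eqP; rewrite eqEcard sY cTJ mind.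
rewrite (bigD1 set0) ?sub0set ?(set_code_perp C).1 //= set0I cards0 expr0.
congr (_ + _); case TJC: (T :|: J \in perp C).
  rewrite (bigD1 (T :|: J)) /=; last by rewrite TJC subxx.
  rewrite mulr1 setIC setKU big1 ?addr0 // => Y /andP[/andP[/andP[YC sY] Y0]].
  by rewrite (onlyTJ Y) ?eqxx.
rewrite mulr0 big1 // => Y /andP[/andP[YC sY] Y0].
by move: TJC; rewrite -(onlyTJ Y) // YC.
Qed.

(** Double counting of pairs of a word [A] and a [j]-subset [J] of it. *)
Lemma momentE T j :
  (moment C T j = \sum_(J in [set J : {set I} | J \subset ~: T & #|J| == j])
     #|[set A in C | [disjoint A & T] && (J \subset A)]|)%N.
Proof.
under [RHS]eq_bigr do rewrite -sum1_card.
rewrite (exchange_big_dep (fun A => (A \in C) && [disjoint A & T])) /=; last first.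
  by move=> J A _; rewrite inE => /andP[-> /andP[->]].
apply: eq_bigr => A /andP[AC dAT]; rewrite -cards_draws -sum1_card.
apply: eq_bigl => J; rewrite !inE AC dAT /=.
case sJA: (J \subset A); rewrite ?andbF // andbT.
by rewrite (subset_trans sJA) // -disjoints_subset.
Qed.

Lemma moment_lt T j : (#|T| + j < d)%N ->
  (2 ^ (#|T| + j) * moment C T j = #|C| * 'C(#|~: T|, j))%N.
Proof.
move=> ltd; rewrite momentE big_distrr /= -cards_draws mulnC -sum_nat_const.
apply: eq_bigr => J; rewrite inE => /andP[sJ /eqP cJ].
by rewrite -cJ pattern_count_lt ?cJ // disjoint_sym disjoints_subset.
Qed.

(** The lowest moment that can detect nonzero dual words: each [J] with [T :|: J] dual yields a
    minimum weight word through [T], from which [J] is recovered by removing [T]. *)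
Lemma moment_eq T j : (0 < d)%N -> (#|T| + j = d)%N ->
  (2 ^ d * moment C T j)%:R =
  #|C|%:R * ('C(#|~: T|, j)%:R + (-1) ^+ j * (covers (layer (perp C) d) T)%:R) :> int.
Proof.
move=> d0 eqd; rewrite momentE big_distrr /= natr_sum.
rewrite (eq_bigr (fun J => #|C|%:R * (1 + (-1) ^+ j * (T :|: J \in perp C)%:R)));
  last first.
  move=> J; rewrite inE => /andP[sJ /eqP cJ].
  by rewrite pattern_count_eq ?cJ // disjoint_sym disjoints_subset.
rewrite -mulr_sumr big_split /= sumr_const cards_draws; congr (_ * (_ + _)).
rewrite -mulr_sumr -natr_sum; congr (_ * _%:R).
have bound (b : bool) : (b : nat) = if b then 1%N else 0%N by case: b.
under eq_bigr do rewrite bound.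
rewrite -big_mkcondr /covers -sum1_card.
rewrite [RHS](reindex_onto (fun J => T :|: J) (fun Y => Y :\: T)) /=; last first.
  move=> Y; rewrite inE => /andP[_ sTY].
  apply/setP=> i; rewrite !inE; have := subsetP sTY i.
  by case: (i \in T) => // ->.
apply: eq_bigl => J; rewrite !inE subsetUl andbT subsets_disjoint setCK.
case dJT: [disjoint J & T] => /=; last first.
  apply/esym/negbTE; rewrite negb_and orbC; apply/orP; left.
  apply: contraFN dJT => /eqP <-; rewrite -setI_eq0.
  by apply/eqP/setP=> i; rewrite !inE; case: (i \in T); rewrite ?andbF.
have cTJ : #|T :|: J| = (#|T| + #|J|)%N.
  by rewrite cardsU setIC (disjoint_setI0 dJT) cards0 subn0.
have -> : (T :|: J) :\: T == J.
  by rewrite setDUl setDv set0U; apply/eqP/setDidPl.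
by rewrite andbT cTJ -eqd eqn_add2l andbC.
Qed.
End Moments.

(** * The Assmus-Mattson argument *)

Section FallingFactorials.
Local Open Scope ring_scope.

Lemma natr_ffactS (x j : nat) :
  (x ^_ j.+1)%:R = (x ^_ j)%:R * (x%:R - j%:R) :> int.
Proof.
rewrite ffactnSr natrM; case: (leqP j x) => [le_jx|lt_xj]; first by rewrite natrB.
by rewrite ffact_small // !mul0r.
Qed.

(** Up to factorials, falling factorials sum over a code to binomial moments; the leading
    coefficient 1 allows the top moment to be solved for. *)
Lemma newton_expansion (r : seq nat) : exists a : nat -> int, a (size r) = 1 /\
  forall x : nat, \prod_(u <- r) (x%:R - u%:R) =
                  \sum_(j < (size r).+1) a j * (x ^_ j)%:R.
Proof.
elim: r => [|u r [a [a1 IHr]]] /=.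
  by exists (fun=> 1); split=> // x; rewrite big_nil big_ord1 mul1r.
(* Nothing is known of [a] beyond index [size r], so [b] truncates it. The new coefficients come
   from x^_j (x - u) = x^_(j+1) + (j - u) x^_j. *)
pose b j := if (j <= size r)%N then a j else 0.
exists (fun j => (if j is i.+1 then a i else 0) + (j%:R - u%:R) * b j); split.
  by rewrite a1 /b ltnn mulr0 addr0.
move=> x; rewrite big_cons IHr mulr_sumr.
under [RHS]eq_bigr do rewrite mulrDl.
rewrite big_split /= [X in _ = X + _]big_ord_recl mul0r add0r [X in _ = _ + X]big_ord_recr /=.
rewrite {2}/b ltnn mulr0 mul0r addr0 -big_split /=; apply: eq_bigr => j _.
by rewrite /b -ltnS ltn_ord /bump /= add1n natr_ffactS; ring.
Qed.

End FallingFactorials.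

Section AssmusMattson.
Local Open Scope ring_scope.
Variables (I : finType) (C : {set {set I}}) (d t : nat) (r : seq nat).
Hypotheses (codeC : set_code C) (mind : min_card (perp C) d).
Hypotheses (d_gt0 : (0 < d)%N) (eq_d : d = (t + size r)%N).
Hypothesis weights : {in C, forall A, A != set0 -> (#|A| + t <= #|I|)%N -> #|A| \in r}.
Implicit Types T : {set I}.

(* The shortened code [A \cap T = 0] has at most [size r] nonzero weights, so
   its moment of order [size r] is determined by the lower ones. *)
Lemma covers_const T1 T2 : #|T1| = t -> #|T2| = t ->
  covers (layer (perp C) d) T1 = covers (layer (perp C) d) T2.
Proof.
move=> cT1 cT2; have [a [a1 aE]] := newton_expansion r.
(* Summed over the shortened code, the polynomial with roots [r] leaves only its value at the empty
   word, whatever [T] is. *)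
have sumM T : #|T| = t ->
    \sum_(j < (size r).+1) a j * (j`! * moment C T j)%:R =
    \prod_(u <- r) (0%:R - u%:R).
  move=> cT; transitivity (\sum_(A in C | [disjoint A & T])
      \prod_(u <- r) (#|A|%:R - u%:R) : int).
    under [RHS]eq_bigr do rewrite aE.
    rewrite exchange_big /=; apply: eq_bigr => j _.
    rewrite -mulr_sumr -natr_sum; congr (_ * _%:R).
    by rewrite big_distrr /=; apply: eq_bigr => A _; rewrite mulnC bin_ffact.
  rewrite (bigD1 set0) /=; last by rewrite codeC.1 -setI_eq0 set0I eqxx.
  rewrite cards0 [X in _ + X]big1 ?addr0 // => A /andP[/andP[AC dAT] A0].
  have Ar : #|A| \in r.
    by apply: weights => //; rewrite -cT -cardsUI (disjoint_setI0 dAT) cards0 addn0 max_card.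
  by rewrite (big_rem _ Ar) /= subrr mul0r.
have cI : #|~: T1| = #|~: T2| by have := cardsC T1; have := cardsC T2; lia.
have eqM j : (j < size r)%N -> moment C T1 j = moment C T2 j.
  move=> ltj; apply/eqP; rewrite -(@eqn_pmul2l (2 ^ (t + j))) ?expn_gt0 //.
  have lt1 : (#|T1| + j < d)%N by rewrite cT1 eq_d ltn_add2l.
  have lt2 : (#|T2| + j < d)%N by rewrite cT2 eq_d ltn_add2l.
  have := moment_lt codeC mind lt1; have := moment_lt codeC mind lt2.
  by rewrite cT1 cT2 cI => -> ->.
have eqMr : moment C T1 (size r) = moment C T2 (size r).
  have := etrans (sumM _ cT1) (esym (sumM _ cT2)).
  rewrite !big_ord_recr /= (eq_bigr (fun j : 'I__ => a j * (j`! * moment C T2 j)%:R)).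
    move/addrI; rewrite a1 !mul1r => /eqP; rewrite eqr_nat eqn_pmul2l ?fact_gt0 //.
    by move/eqP.
  by move=> j _; rewrite eqM.
have C0 : #|C|%:R != 0 :> int.
  by rewrite pnatr_eq0 -lt0n card_gt0; apply/set0Pn; exists set0; apply: codeC.1.
have := moment_eq codeC mind d_gt0 (etrans (congr1 (addn^~ _) cT1) (esym eq_d)).
rewrite eqMr (moment_eq codeC mind d_gt0 (etrans (congr1 (addn^~ _) cT2) (esym eq_d))).
move/(mulfI C0); rewrite cI => /addrI /(mulfI (negbT (signr_eq0 _ _))) /eqP.
by rewrite eqr_nat => /eqP.
Qed.

End AssmusMattson.

Lemma covers_count (I : finType) (B : {set {set I}}) (k : nat) (T : {set I}) :
  {in B, forall Y : {set I}, #|Y| = k} ->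
  \sum_(p in ~: T) covers B (p |: T) = (k - #|T|) * covers B T.
Proof.
move=> cB; under eq_bigr do rewrite /covers -sum1dep_card.
rewrite (exchange_big_dep (fun Y => (Y \in B) && (T \subset Y))) /=; last first.
  by move=> p Y _ /andP[->]; rewrite subUset => /andP[].
rewrite /covers -sum1dep_card big_distrr /=; apply: eq_bigr => Y /andP[YB sTY].
rewrite muln1 -(cB Y YB) -cardsDS // -sum1_card; apply: eq_bigl => p.
by rewrite !inE YB subUset sub1set sTY andbT /= andbC.
Qed.

(** A list rather than a number, so that it can serve as the roots in the Newton expansion. *)
Definition weights_upto (I : finType) (C : {set {set I}}) (m : nat) : seq nat :=
  [seq u <- iota 1 m | [exists A in C, #|A| == u]].

Lemma mem_weights_upto (I : finType) (C : {set {set I}}) (m : nat) (A : {set I}) :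
  A \in C -> (#|A| \in weights_upto C m) = (0 < #|A| <= m).
Proof.
move=> AC; rewrite mem_filter mem_iota add1n ltnS.
by rewrite (_ : [exists B in C, _]) //; apply/exists_inP; exists A.
Qed.

(** * Blocks and weights under the equation [d = t + size r] *)

Section ExtremalCode.
Variables (I : finType) (C : {set {set I}}) (d t : nat) (B0 : {set I}).
Hypotheses (codeC : set_code C) (TC : setT \in C).
Hypotheses (mind : min_card (perp C) d) (B0C : B0 \in perp C) (cB0 : #|B0| = d).
Let r := weights_upto C (#|I| - t).
Hypotheses (t_gt0 : 0 < t) (eq_d : d = t + size r) (r_gt0 : 0 < size r).
Let blocks := layer (perp C) d.
Implicit Types A T Y : {set I}.

Lemma even_perp Y : Y \in perp C -> ~~ odd #|Y|.
Proof. by move/perpP/(_ _ TC); rewrite setTI. Qed.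

Lemma covers_eq T1 T2 : #|T1| = t -> #|T2| = t -> covers blocks T1 = covers blocks T2.
Proof.
apply: (covers_const (r := r) codeC mind) => //; first by rewrite eq_d addn_gt0 t_gt0.
move=> A AC A0 leA; rewrite mem_weights_upto // card_gt0 A0 /=.
by rewrite leq_subRL ?(leq_trans (leq_addl _ _) leA) // addnC.
Qed.

(** By constancy one [t]-set suffices, chosen inside the block [B0]. *)
Lemma covers_gt0 T : #|T| = t -> 0 < covers blocks T.
Proof.
move=> cT; have [||T0 [_ sT0 cT0]] := @exists_set_between _ set0 B0 t.
- exact: sub0set.
- by rewrite cards0 cB0 eq_d leq_addr.
rewrite (covers_eq cT cT0) card_gt0; apply/set0Pn; exists B0.
by rewrite inE sT0 andbT; apply/layerP.
Qed.

Lemma exists_block T : #|T| <= t ->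
  exists Y, [/\ Y \in perp C, #|Y| = d & T \subset Y].
Proof.
move=> cT; have [||T' [sT _ cT']] := @exists_set_between _ T setT t.
- exact: subsetT.
- by rewrite cT cardsT /= -(cardsC B0) cB0 eq_d -addnA leq_addr.
have := covers_gt0 cT'; rewrite card_gt0 => /set0Pn[Y].
rewrite inE => /andP[/layerP[YC cY] sY]; exists Y; split=> //.
exact: subset_trans sY.
Qed.

(** If [d = #|I|], then [size r = #|I| - t], so every weight from 1 to [#|I| - t] occurs, weight 1
    among them; but [B0] is then the whole set and forces all weights to be even. *)
Lemma ltn_min_card : d < #|I|.
Proof.
rewrite ltn_neqAle -{2}cB0 max_card andbT; apply/eqP=> eq_dn.
have BT : B0 = setT by apply/eqP; rewrite eqEcard subsetT cardsT cB0 eq_dn /=.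
have : all (fun u => [exists A in C, #|A| == u]) (iota 1 (#|I| - t)).
  by rewrite all_count -size_filter size_iota -eq_dn {2}eq_d addKn eq_dn.
move/allP/(_ 1); rewrite mem_iota => /(_ _)/exists_inP[|A AC /eqP cA]; first lia.
by have /perpP/(_ _ AC) := B0C; rewrite BT setIT cA.
Qed.

(* Blocks through a common [(t-1)]-subset of another block: their symmetric
   difference is a nonzero dual word. *)
Lemma leq_double_t : (t.-1).*2 <= d.
Proof.
have [||T [_ sT cT]] := @exists_set_between _ set0 B0 t.-1.
- exact: sub0set.
- by rewrite cards0 cB0 eq_d; lia.
(* A point outside [B0] keeps the block through it distinct from [B0]. *)
have /properP[_ [p _ pB0]] : B0 \proper setT.
  by rewrite properEcard subsetT cardsT cB0 ltn_min_card.
have [|Y [YC cY]] := @exists_block (p |: T).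
  by rewrite cardsU1 cT; case: (p \in T) => /=; lia.
rewrite subUset sub1set => /andP[pY sTY].
have neqBY : symdiff B0 Y != set0.
  by rewrite symdiff_eq0; apply: contraNneq pB0 => ->.
have := mind ((set_code_perp C).2 _ _ B0C YC) neqBY.
have := card_symdiff B0 Y; rewrite cB0 cY.
have : t.-1 <= #|B0 :&: Y| by rewrite -cT subset_leq_card // subsetI sT.
lia.
Qed.

(* Otherwise take [|T| = t-1] containing all points of [A] but one, [q]: by
   parity every block through [T] contains [q], so [T] and [q |: T] lie in
   equally many blocks, which double counting excludes unless [d = #|I|]. *)
Lemma leq_t_weight A : A \in C -> A != set0 -> t <= #|A|.
Proof.
move=> AC A0; rewrite leqNgt; apply/negP => ltAt.
(* A block containing the short word [A] is orthogonal to it. *)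
have evenA : ~~ odd #|A|.
  have [|Y [/perpP/(_ _ AC) YC _ /setIidPl AY]] := @exists_block A; first exact: ltnW.
  by rewrite AY in YC.
have [q qA] := set0Pn _ A0.
have cAq := cardsD1 q A; rewrite qA in cAq.
have ltdn := ltn_min_card.
have [||T [sT /subsetP sTq cT]] := @exists_set_between _ (A :\ q) (~: [set q]) t.-1.
- by apply/subsetP=> x; rewrite !inE => /andP[].
- by have := cardsC [set q]; rewrite cards1; lia.
have qT : q \notin T by apply/negP => /sTq; rewrite !inE eqxx.
have cvT : covers blocks T = covers blocks (q |: T).
  apply: eq_card => Y; rewrite !inE subUset sub1set; apply: andb_id2l => /andP[YC _].
  case sTY: (T \subset Y); rewrite (andbT, andbF) //; apply/esym.
  apply: contraTT YC => qY; apply/negP => /forall_inP/(_ _ AC).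
  have -> : A :&: Y = A :\ q.
    apply/setP=> x; rewrite !inE; case: eqP => [->|xq] /=; first by rewrite (negbTE qY) andbF.
    case xA: (x \in A) => //=; apply: (subsetP sTY); apply: (subsetP sT).
    by rewrite !inE xA andbT; apply/eqP.
  by move: evenA; rewrite cAq /= negbK add0n => ->.
have := @covers_count _ blocks d T; rewrite cT => /(_ _) cc.
have {}cc : \sum_(p in ~: T) covers blocks (p |: T) = (d - t.-1) * covers blocks T.
  by apply: cc => Y /layerP[].
have cqT : #|q |: T| = t by rewrite cardsU1 qT cT; lia.
have := covers_gt0 cqT; move: cc.
rewrite (eq_bigr (fun=> covers blocks (q |: T))); last first.
  move=> p; rewrite inE => pT; apply: covers_eq => //.
  by rewrite cardsU1 pT cT; lia.
rewrite sum_nat_const cvT => /eqP; have := cardsC T; rewrite cT => cTC.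
move=> + l0; rewrite eqn_pmul2r // => /eqP; lia.
Qed.

(** The complement of [A] is also a nonempty word of [C], so it has at least [t] points and [A] at
    most [#|I| - t]. *)
Lemma mem_weights A : A \in C -> A != set0 -> A != setT -> #|A| \in r.
Proof.
move=> AC A0 AT; have ACC : ~: A \in C by rewrite -symdiffT; apply: codeC.2.
have AC0 : ~: A != set0 by rewrite -(inj_eq (@setC_inj _)) setCK setC0.
have := leq_t_weight ACC AC0; rewrite mem_weights_upto // card_gt0 A0 /=.
by rewrite -(cardsC A); lia.
Qed.

End ExtremalCode.

(** * Exclusion of (6,4) *)

(** For f = g = 1 only the empty word survives on the left, with value 2^n, so |C| |C^perp| =
    2^n. *)
Lemma card_set_code_dvdn (I : finType) (C : {set {set I}}) :
  set_code C -> #|C| %| 2 ^ #|I|.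
Proof.
move=> codeC; apply/dvdnP; exists #|perp C|; apply/eqP.
have := macwilliams codeC (fun=> 1%R : int) (fun=> 1%R).
rewrite (bigD1 set0) ?codeC.1 //= [X in (_ + X)%R]big1 ?addr0; last first.
  move=> A /andP[_ /set0Pn[i iA]]; by rewrite (bigD1 i) //= iA mul0r.
rewrite (eq_bigr (fun=> 2%:R%R)); last by move=> i _; rewrite inE.
rewrite prodr_const [X in (_ * X)%R](eq_bigr (fun=> 1%R)); last first.
  by move=> Y _; rewrite big1 // => i _; rewrite if_same.
by rewrite sumr_const -natrX -natrM => /eqP; rewrite eqr_nat mulnC.
Qed.

Section PowerMoments.
Local Open Scope ring_scope.
Variables (I : finType) (C : {set {set I}}) (d : nat).
Hypotheses (codeC : set_code C) (mind : min_card (perp C) d).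
Let n : int := #|I|%:R.
Let K : int := #|C|%:R.

Lemma ffact_moment j : (j < d)%N ->
  2 ^+ j * \sum_(A in C) (#|A| ^_ j)%:R = K * (#|I| ^_ j)%:R :> int.
Proof.
move=> ltjd; have lt0jd : (#|@set0 I| + j < d)%N by rewrite cards0.
have := moment_lt codeC mind lt0jd; rewrite cards0 add0n setC0 cardsT.
move/(congr1 (fun m => (m * j`!)%N%:R : int)) => /=.
rewrite -!mulnA bin_ffact !natrM natrX => <-; congr (_ * _).
rewrite -natrM /moment big_distrl natr_sum; apply: eq_big => A.
  by rewrite -setI_eq0 setI0 eqxx andbT.
by move=> _ /=; rewrite bin_ffact.
Qed.

Lemma second_moment : (2 < d)%N ->
  \sum_(A in C) (n - 2 * #|A|%:R) ^+ 2 = K * n.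
Proof.
move=> ltd; have m j : (j <= 2)%N -> _ := fun h => ffact_moment (leq_ltn_trans h ltd).
transitivity ((2 ^+ 2 * \sum_(A in C) (#|A| ^_ 2)%:R)
  + (2 - 2 * n) * (2 ^+ 1 * \sum_(A in C) (#|A| ^_ 1)%:R)
  + n ^+ 2 * (2 ^+ 0 * \sum_(A in C) (#|A| ^_ 0)%:R) : int).
  rewrite !mulr_sumr -!big_split; apply: eq_bigr => A _ /=.
  by rewrite !natr_ffactS ffactn0; ring.
by rewrite !m // !natr_ffactS ffactn0 -/n; ring.
Qed.

Lemma fourth_moment : (4 < d)%N ->
  \sum_(A in C) (n - 2 * #|A|%:R) ^+ 4 = K * (3 * n ^+ 2 - 2 * n).
Proof.
move=> ltd; have m j : (j <= 4)%N -> _ := fun h => ffact_moment (leq_ltn_trans h ltd).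
(* Coefficients of (n - 2x)^4 in terms of 2^j x^_j, the form in which [ffact_moment] applies. *)
transitivity ((2 ^+ 4 * \sum_(A in C) (#|A| ^_ 4)%:R)
  + (12 - 4 * n) * (2 ^+ 3 * \sum_(A in C) (#|A| ^_ 3)%:R)
  + (28 - 24 * n + 6 * n ^+ 2) * (2 ^+ 2 * \sum_(A in C) (#|A| ^_ 2)%:R)
  + (8 - 16 * n + 12 * n ^+ 2 - 4 * n ^+ 3) *
      (2 ^+ 1 * \sum_(A in C) (#|A| ^_ 1)%:R)
  + n ^+ 4 * (2 ^+ 0 * \sum_(A in C) (#|A| ^_ 0)%:R) : int).
  rewrite !mulr_sumr -!big_split; apply: eq_bigr => A _ /=.
  by rewrite !natr_ffactS ffactn0; ring.
by rewrite !m // !natr_ffactS ffactn0 -/n; ring.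
Qed.

End PowerMoments.

Lemma big_code (R : nmodType) (I : finType) (C : {set {set I}}) (F : {set I} -> R) :
  set0 \in C -> setT \in C -> 0 < #|I| ->
  (\sum_(A in C) F A =
   F set0 + (F setT + \sum_(A in C | (A != set0) && (A != setT)) F A))%R.
Proof.
move=> C0 CT I0; rewrite (bigD1 set0) //=; congr (_ + _)%R.
have T0 : setT != set0 :> {set I} by rewrite -card_gt0 cardsT.
rewrite (bigD1 setT) /=; last by rewrite CT.
by congr (_ + _)%R; apply: eq_bigl => A; rewrite andbA.
Qed.

(** Here [v] is the common value of (n - 2|A|)^2 on the K - 2 nontrivial words. Multiplying the
    fourth moment by K - 2 and substituting (K - 2)v from the second eliminates [v]. *)
Lemma tight_parameters (n K v : int) :
  (1 < n -> K != 0 -> 2 * n ^+ 2 + (K - 2) * v = K * n ->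
  2 * n ^+ 4 + (K - 2) * v ^+ 2 = K * (3 * n ^+ 2 - 2 * n) ->
  K = n ^+ 2 - n + 2 /\ v = n - 2)%R.
Proof.
move=> n1 K0 E2 E4; have n0 : (n != 0)%R by lia.
have n10 : (n - 1 != 0)%R by lia.
have EK : (K = n ^+ 2 - n + 2)%R.
  have : (2 * K * n * (n - 1) * (K - (n ^+ 2 - n + 2)) = 0)%R.
    have h : ((K - 2) * v = K * n - 2 * n ^+ 2)%R by rewrite -E2; ring.
    have h2 : ((K - 2) * (2 * n ^+ 4 + (K - 2) * v ^+ 2) =
               2 * (K - 2) * n ^+ 4 + (K * n - 2 * n ^+ 2) ^+ 2)%R by rewrite -h; ring.
    have := h2; rewrite E4 => h3.
    have -> : (2 * K * n * (n - 1) * (K - (n ^+ 2 - n + 2)) =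
      (K - 2) * (K * (3 * n ^+ 2 - 2 * n)) -
      (2 * (K - 2) * n ^+ 4 + (K * n - 2 * n ^+ 2) ^+ 2))%R by ring.
    by rewrite h3 subrr.
  by move/eqP; rewrite !mulf_eq0 (negbTE K0) (negbTE n0) (negbTE n10) /= subr_eq0 => /eqP.
split=> //; apply/eqP; rewrite -subr_eq0.
have : (n * (n - 1) * (v - (n - 2)) = 0)%R.
  have -> : (n * (n - 1) * (v - (n - 2)) =
             2 * n ^+ 2 + (n ^+ 2 - n + 2 - 2) * v - (n ^+ 2 - n + 2) * n)%R by ring.
  by rewrite -EK E2 subrr.
by move/eqP; rewrite !mulf_eq0 (negbTE n0) (negbTE n10).
Qed.

(** Both factors are powers of two, so the smaller divides their difference 2m, which it exceeds
    once m > 2. *)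
Lemma leq_two_factors m e : (m * m + m + 2) * (m * m - m + 2) %| 2 ^ e -> m <= 2.
Proof.
move=> dv.
have /(dvdn_pfactor _ _ (isT : prime 2))[a _ Ea] :=
  dvdn_trans (dvdn_mulr _ (dvdnn _)) dv.
have /(dvdn_pfactor _ _ (isT : prime 2))[b _ Eb] :=
  dvdn_trans (dvdn_mull _ (dvdnn _)) dv.
rewrite leqNgt; apply/negP => m3.
have le_ba : b <= a by rewrite -(leq_exp2l (m := 2)) // -Ea -Eb; nia.
have : 2 ^ b %| 2 * m.
  have -> : 2 * m = 2 ^ a - 2 ^ b by rewrite -Ea -Eb; nia.
  by rewrite dvdn_sub ?dvdn_exp2l.
by move/dvdn_leq => /(_ _); rewrite -Eb; nia.
Qed.

Section NoSixFour.
Variables (I : finType) (C : {set {set I}}) (d t : nat) (B0 : {set I}).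
Hypotheses (codeC : set_code C) (TC : setT \in C).
Hypotheses (mind : min_card (perp C) d) (B0C : B0 \in perp C) (cB0 : #|B0| = d).
Let r := weights_upto C (#|I| - t).
Hypotheses (t_gt0 : 0 < t) (eq_d : d = t + size r).

(** Complementation permutes the two weights; fixing both would make both equal to half the
    length. *)
Lemma weights_two : size r = 2 -> exists u : nat,
  {in C, forall A, A != set0 -> A != setT -> #|A| = u \/ #|A| + u = #|I|}.
Proof.
move=> r2; have r0 : 0 < size r by rewrite r2.
have in_r := mem_weights codeC TC mind B0C cB0 t_gt0 eq_d r0.
have ur : uniq r by rewrite filter_uniq ?iota_uniq.
have sym u : u \in r -> #|I| - u \in r /\ u <= #|I|.
  rewrite mem_filter mem_iota => /andP[/exists_inP[A inC /eqP cA]].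
  rewrite -(cardsC A) => hA.
  have ACC : ~: A \in C by rewrite -symdiffT; apply: codeC.2.
  have -> : #|A| + #|~: A| - u = #|~: A| by lia.
  split; last by lia.
  apply: in_r => //; first by rewrite -card_gt0; lia.
  by rewrite -(inj_eq (@setC_inj _)) setCK setCT -card_gt0; lia.
have [u1 [u2 Er]] : exists u1 u2, r = [:: u1; u2].
  by move: r2; case: r => [|u1 [|u2 [|]]] // _; exists u1, u2.
rewrite -/r Er in in_r ur sym; have {ur} neq12 : u1 <> u2.
  by move: ur; rewrite /= inE andbT => /eqP.
have [s1 le1] := sym u1 (mem_head _ _).
have [s2 le2] : #|I| - u2 \in [:: u1; u2] /\ u2 <= #|I|.
  by apply: sym; rewrite !inE eqxx orbT.
exists u1 => A inC A0 AT; move: (in_r A inC A0 AT) s1 s2; rewrite !inE.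
move=> /orP[/eqP -> _ _|/eqP -> /orP[]/eqP h1 /orP[]/eqP h2];
  first [by left|by right; lia|lia].
Qed.

Local Open Scope ring_scope.

Lemma not_six_four : d = 6 -> t = 4 -> size r <> 2%N.
Proof.
move=> d6 t4 r2; have r0 : (0 < size r)%N by rewrite r2.
have n6 := ltn_min_card TC B0C cB0 t_gt0 eq_d r0; rewrite d6 in n6.
have I0 : (0 < #|I|)%N by apply: leq_trans n6.
have [u uP] := weights_two r2.
pose n : int := #|I|%:R; pose x := n - 2 * u%:R; pose v := x ^+ 2.
have others (F : {set I} -> int) (c : int) :
    {in C, forall A, A != set0 -> A != setT -> F A = c} ->
    \sum_(A in C) F A = F set0 + F setT + (#|C|%:R - 2) * c.
  move=> Fc; have cC := big_code (fun=> 1 : int) codeC.1 TC I0.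
  rewrite big_code ?codeC.1 // addrA; congr (_ + _).
  rewrite (eq_bigr (fun=> c * 1)); last first.
    by move=> A /andP[inC /andP[A0 AT]]; rewrite mulr1 Fc.
  rewrite -mulr_sumr mulrC; congr (_ * _).
  by move: cC; rewrite sumr_const => ->; ring.
have sq A : A \in C -> A != set0 -> A != setT -> (n - 2 * #|A|%:R) ^+ 2 = v.
  move=> inC A0 AT; rewrite /v /x; case: (uP A inC A0 AT) => [->//|E].
  have -> : n = #|A|%:R + u%:R by rewrite -natrD E.
  by ring.
have ends e : odd e = false ->
    (n - 2 * #|@set0 I|%:R) ^+ e + (n - 2 * #|[set: I]|%:R) ^+ e = 2 * n ^+ e.
  move=> oe; rewrite cards0 cardsT -/n mulr0 subr0.
  have -> : n - 2 * n = - n by ring.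
  by rewrite exprNn -signr_odd oe expr0 mul1r; ring.
have d2 : (2 < d)%N by rewrite d6. have d4 : (4 < d)%N by rewrite d6.
have := second_moment codeC mind d2; rewrite (others _ v) // ends // => E2.
have := fourth_moment codeC mind d4; rewrite (others _ (v ^+ 2)); last first.
  by move=> A inC A0 AT; rewrite -(sq A) // -exprM.
rewrite ends // => E4.
have K0 : #|C|%:R != 0 :> int.
  by rewrite pnatr_eq0 -lt0n card_gt0; apply/set0Pn; exists set0; apply: codeC.1.
have n1 : 1 < n by rewrite /n ltr1n; apply: leq_trans n6.
have [EK Ev] := tight_parameters n1 K0 E2 E4.
(* From v = n - 2 follows n = m^2 + 2, and then n^2 - n + 2 = (m^2 + 2)^2 - m^2 factors. *)
pose m := absz x.
have Em : v = m%:R ^+ 2.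
  by rewrite /v /m [X in _ = X ^+ _]natz abszE -normrX ger0_norm ?sqr_ge0.
have En : n = m%:R ^+ 2 + 2 by rewrite -Em Ev; ring.
have EnN : #|I| = (m * m + 2)%N.
  by apply/eqP; rewrite -(eqr_nat int) -/n En natrD natrM expr2.
have EKN : #|C| = ((m * m + m + 2) * (m * m - m + 2))%N.
  apply/eqP; rewrite -(eqr_nat int) EK En natrM !natrD natrB ?natrM; first by apply/eqP; ring.
  by case: (m) => // m'; rewrite leq_pmulr.
have := card_set_code_dvdn codeC; rewrite EKN => /leq_two_factors m2.
by move: n6; rewrite EnN ltnNge (leq_add (leq_mul m2 m2) (leqnn 2)).
Qed.
End NoSixFour.

(** * Codes with a single nontrivial weight *)

Section SingleWeight.
Local Open Scope ring_scope.
Variables (I : finType) (C : {set {set I}}) (d h : nat).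
Hypotheses (codeC : set_code C) (TC : setT \in C) (mind : min_card (perp C) d).
Hypotheses (h_gt0 : (0 < h)%N) (card_I : #|I| = h.*2).
Hypothesis weight_h : {in C, forall A, A != set0 -> A != setT -> #|A| = h}.
Implicit Types A T Y : {set I}.

Definition cover_poly (B : {set {set I}}) T : {poly int} :=
  \sum_(Y in B | T \subset Y) 'X^#|Y|.

Lemma coef_cover_poly (B : {set {set I}}) T w :
  (cover_poly B T)`_w = (covers (layer B w) T)%:R.
Proof.
rewrite /cover_poly coef_sum /covers -sum1_card natr_sum.
rewrite big_mkcondr [RHS]big_mkcond [LHS]big_mkcond; apply: eq_bigr => Y _.
rewrite !inE coefXn; case: (Y \in B) => //=; rewrite (eq_sym w).
by case: (T \subset Y); case: (_ == w).
Qed.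

Lemma prod_cells (R : comNzRingType) A T (a b c e : R) :
  \prod_i (if i \in T then (if i \in A then a else b)
           else (if i \in A then c else e)) =
  a ^+ #|A :&: T| * b ^+ #|T :\: A| * c ^+ #|A :\: T| * e ^+ #|~: (A :|: T)|.
Proof.
rewrite -!prodr_const [X in _ * X]big_mkcond [X in _ * X * _]big_mkcond.
rewrite [X in _ * X * _ * _]big_mkcond [X in _ = X * _ * _ * _]big_mkcond.
rewrite -!big_split; apply: eq_bigr => i _ /=.
by rewrite !inE; case: (i \in A); case: (i \in T); rewrite /= ?mulr1 ?mul1r.
Qed.

Lemma card_cells A T (j := #|A :&: T|) :
  [/\ #|T :\: A| = (#|T| - j)%N, #|A :\: T| = (#|A| - j)%N,
      #|~: (A :|: T)| = (#|I| + j - #|A| - #|T|)%N, (j <= #|A|)%N & (j <= #|T|)%N].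
Proof.
have hA := cardsID T A; have hT := cardsID A T; rewrite setIC in hT.
have hU := cardsUI A T; have hC := cardsC (A :|: T).
rewrite -hC {}/j; split; lia.
Qed.

(** Up to the factor |C|, this is the sum over [A] in [C] of the product over [T] of chi_i - X,
    where chi_i is -1 on [A] and 1 off it. *)
Let shift_poly T : {poly int} :=
  \sum_(Y in perp C | Y \subset T) (- 'X) ^+ (#|T| - #|Y|).

(* Every word of weight [h] contributes
   [X^r (1 - X^2)^(h-r) \prod_(i in T) (chi_i - X)] to the transform of
   [X^|Y| 1_(T \subset Y)]; the sum over [C] of the last product is again
   given by the MacWilliams identity. *)
Lemma cover_polyE T (k := #|T|) : (k <= h)%N ->
  #|C|%:R * cover_poly (perp C) T =
  'X^k * (1 + 'X) ^+ (h.*2 - k) + (- 'X) ^+ k * (1 - 'X) ^+ (h.*2 - k)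
  + 'X^k * (1 - 'X ^+ 2) ^+ (h - k) *
    (#|C|%:R * shift_poly T - (1 - 'X) ^+ k - (- 1 - 'X) ^+ k).
Proof.
move=> lekh.
pose E A : {poly int} := (- 'X) ^+ #|A :&: T| * 'X ^+ #|T :\: A| *
  (1 - 'X) ^+ #|A :\: T| * (1 + 'X) ^+ #|~: (A :|: T)|.
pose P A : {poly int} := (- 1 - 'X) ^+ #|A :&: T| * (1 - 'X) ^+ #|T :\: A|.
(* Taking g = 0 on [T] selects the dual words containing [T]. *)
have sumE : \sum_(A in C) E A = #|C|%:R * cover_poly (perp C) T.
  have := macwilliams codeC (fun=> 'X : {poly int}) (fun i => (i \notin T)%:R).
  rewrite (eq_bigr E) => [->|A _]; last first.
    rewrite /E -prod_cells; apply: eq_bigr => i _.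
    by case: (i \in T); case: (i \in A) => /=; ring.
  congr (_ * _); rewrite [RHS]big_mkcondr; apply: eq_bigr => Y _.
  case: ifP => [sTY|/negbT/subsetPn[i iT iY]].
    rewrite -prodr_const [RHS]big_mkcond; apply: eq_bigr => i _.
    case: ifP => // /negbT iY.
    by rewrite (contra (subsetP sTY i) iY).
  by rewrite (bigD1 i) //= (negbTE iY) iT mul0r.
have sumP : \sum_(A in C) P A = #|C|%:R * shift_poly T.
  have := macwilliams codeC (fun i => (i \in T)%:R : {poly int})
            (fun i => if i \in T then - 'X else 1).
  rewrite (eq_bigr P) => [->|A _]; last first.
    transitivity (P A * 1 ^+ #|A :\: T| * 1 ^+ #|~: (A :|: T)|).
      rewrite /P -prod_cells; apply: eq_bigr => i _.
      by case: (i \in T); case: (i \in A) => /=; ring.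
    by rewrite !expr1n !mulr1.
  congr (_ * _); rewrite [RHS]big_mkcondr; apply: eq_bigr => Y _.
  case: ifP => [sYT|/negbT/subsetPn[i iY iT]].
    rewrite -cardsDS // -prodr_const [RHS]big_mkcond; apply: eq_bigr => i _.
    rewrite !inE; case: ifP => //= /(subsetP sYT) -> //.
  by rewrite (bigD1 i) //= iY (negbTE iT) mul0r.
(* For |A| = h both 1 - X and 1 + X occur at least h - k times, which splits off a power of 1 -
   X^2. *)
have EP A : #|A| = h -> E A = 'X^k * (1 - 'X ^+ 2) ^+ (h - k) * P A.
  move=> cA; rewrite /E /P; have [-> -> -> jA jT] := card_cells A T.
  move: jA jT; rewrite cA card_I -/k; move: #|A :&: T| => j jh jk.
  have -> : (h.*2 + j - h - k = (h - k) + j)%N by lia.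
  have -> : (h - j = (h - k) + (k - j))%N by lia.
  have -> : 'X^k = 'X^j * 'X^(k - j) :> {poly int} by rewrite -exprD subnKC.
  have -> : (- 1 - 'X) ^+ j = (- 1) ^+ j * (1 + 'X) ^+ j :> {poly int}.
    by rewrite -exprMn; congr (_ ^+ _); ring.
  have -> : (1 - 'X ^+ 2) ^+ (h - k) = (1 - 'X) ^+ (h - k) * (1 + 'X) ^+ (h - k)
     :> {poly int} by rewrite -exprMn; congr (_ ^+ _); ring.
  by rewrite (exprNn 'X) !exprD; ring.
have I0 : (0 < #|I|)%N by rewrite card_I double_gt0.
have := big_code E codeC.1 TC I0; have := big_code P codeC.1 TC I0.
rewrite sumE sumP => -> ->.
rewrite [X in _ + (_ + X) = _](eq_bigr (fun A => 'X^k * (1 - 'X ^+ 2) ^+ (h - k) * P A));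
  last by move=> A /andP[AC /andP[A0 AT]]; rewrite EP ?weight_h.
rewrite -mulr_sumr.
have -> : E set0 = 'X^k * (1 + 'X) ^+ (h.*2 - k).
  rewrite /E; have [-> -> -> _ _] := card_cells set0 T.
  by rewrite set0I cards0 !subn0 addn0 card_I !expr0 mul1r mulr1.
have -> : E setT = (- 'X) ^+ k * (1 - 'X) ^+ (h.*2 - k).
  rewrite /E; have [-> -> -> _ _] := card_cells setT T.
  rewrite setTI cardsT card_I subnn.
  have -> : (h.*2 + #|T| - h.*2 - #|T| = 0)%N by lia.
  by rewrite !expr0 !mulr1.
have -> : P set0 = (1 - 'X) ^+ k by rewrite /P set0I cards0 setD0 mul1r.
have -> : P setT = (- 1 - 'X) ^+ k by rewrite /P setTI setDT cards0 mulr1.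
by rewrite -/k; ring.
Qed.

Lemma shift_poly_lt T : (#|T| < d)%N -> shift_poly T = (- 'X) ^+ #|T|.
Proof.
move=> ltd; rewrite /shift_poly (bigD1 set0) ?(set_code_perp C).1 ?sub0set //=.
rewrite cards0 subn0 big1 ?addr0 // => Y /andP[/andP[YC /subset_leq_card leYT] Y0].
by have := leq_trans (mind YC Y0) leYT; rewrite leqNgt ltd.
Qed.

(** A nonempty dual word inside [T] can only be [T] itself; at this size the transform may depend on
    more than [#|T|]. *)
Lemma shift_poly_eq T : (0 < d)%N -> #|T| = d ->
  shift_poly T = (- 'X) ^+ d + (T \in perp C)%:R.
Proof.
move=> d0 cT; rewrite /shift_poly (bigD1 set0) ?(set_code_perp C).1 ?sub0set //=.
rewrite cards0 subn0 cT; congr (_ + _).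
have onlyT Y : Y \in perp C -> Y \subset T -> Y != set0 -> Y = T.
  by move=> YC sY Y0; apply/eqP; rewrite eqEcard sY cT mind.
have T0 : T != set0 by rewrite -card_gt0 cT.
case TP: (T \in perp C).
  rewrite (bigD1 T) ?TP ?subxx ?T0 //= cT subnn expr0 big1 ?addr0 //.
  by move=> Y /andP[/andP[/andP[YC sY] Y0]]; rewrite (onlyT Y) ?eqxx.
rewrite big1 // => Y /andP[/andP[YC sY] Y0].
by move: TP; rewrite -(onlyT Y) // YC.
Qed.

Let card_C_neq0 : #|C|%:R != 0 :> {poly int}.
Proof.
rewrite -polyC_natr polyC_eq0 pnatr_eq0 -lt0n card_gt0.
by apply/set0Pn; exists set0; apply: codeC.1.
Qed.

Lemma covers_perp_lt T T' w : (#|T| < d)%N -> (#|T| <= h)%N -> #|T'| = #|T| ->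
  covers (layer (perp C) w) T' = covers (layer (perp C) w) T.
Proof.
move=> ltd leh cT'; apply/eqP; rewrite -(eqr_nat int) -!coef_cover_poly.
suff -> : cover_poly (perp C) T' = cover_poly (perp C) T by [].
by apply: (mulfI card_C_neq0); rewrite !cover_polyE ?cT' // !shift_poly_lt ?cT'.
Qed.

Lemma coef_sub_sqr_exp m i :
  ((1 - 'X ^+ 2 : {poly int}) ^+ m)`_(i.*2) = (-1) ^+ i * 'C(m, i)%:R.
Proof.
have -> : (1 - 'X ^+ 2 : {poly int}) ^+ m = ((1 - 'X) ^+ m) \Po 'X^2.
  by rewrite rmorphXn /= rmorphB /= comp_polyX -polyC1 comp_polyC.
rewrite -muln2 coef_comp_poly_Xn // dvdn_mull // mulnK //.
have -> : (1 - 'X : {poly int}) ^+ m = \poly_(j < m.+1) ((-1) ^+ j * 'C(m, j)%:R).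
  rewrite poly_def exprBn; apply: eq_bigr => j _.
  rewrite expr1n mulr1 -mulr_natr -polyC1 -polyCN -polyC_exp mulrAC.
  by rewrite -polyC_natr -polyCM mul_polyC.
by rewrite coef_poly; case: ltnP => // ltmi; rewrite bin_small // mulr0.
Qed.

(** The two transforms differ by X^d (1 - X^2)^(h-d), whose coefficient at X^w is, up to sign, the
    binomial of h - d over (w - d)/2; the bounds on [w] keep it nonzero. *)
Lemma covers_perp_eq T T' w : (0 < d <= h)%N -> #|T| = d -> #|T'| = d ->
  T \in perp C -> T' \notin perp C ->
  ~~ odd w -> ~~ odd d -> (d <= w)%N -> (w + d <= h.*2)%N ->
  covers (layer (perp C) w) T' <> covers (layer (perp C) w) T.
Proof.
move=> /andP[d0 dh] cT cT' TP /negbTE T'P ow od dw wd.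
have : cover_poly (perp C) T - cover_poly (perp C) T' =
       'X^d * (1 - 'X ^+ 2) ^+ (h - d).
  apply: (mulfI card_C_neq0); rewrite mulrBr !cover_polyE ?cT ?cT' //.
  by rewrite !shift_poly_eq // TP T'P /=; ring.
move/(congr1 (fun p : {poly int} => p`_w)); rewrite coefB !coef_cover_poly.
rewrite coefXnM ltnNge dw /=.
have [i Ei] : exists i, (w - d = i.*2)%N.
  by exists (w - d)./2; rewrite even_halfK // oddB // (negbTE ow) (negbTE od).
rewrite Ei coef_sub_sqr_exp => E eqc; move: E; rewrite eqc subrr => /esym/eqP.
by rewrite mulf_eq0 signr_eq0 pnatr_eq0 eqn0Ngt bin_gt0; lia.
Qed.

(** The successor accounts for [setT]; a nonempty [T] excludes the empty word. *)
Lemma card_containing T : (0 < #|T|)%N ->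
  (covers (layer C h) T).+1 = #|[set A in C | T \subset A]|.
Proof.
move=> T0; rewrite (cardsD1 setT) inE TC subsetT add1n; congr _.+1.
apply: eq_card => A; rewrite !inE; have [->|AT] /= := eqVneq A setT.
  rewrite cardsT card_I; case: eqP => [Eh|]; last by rewrite andbF.
  by move: h_gt0 Eh; lia.
case AC: (A \in C) => //=; case sTA: (T \subset A); rewrite (andbT, andbF) //.
rewrite weight_h ?eqxx // -card_gt0; exact: leq_trans T0 (subset_leq_card sTA).
Qed.

Lemma covers_code_lt T : (0 < #|T| < d)%N ->
  (2 ^ #|T| * (covers (layer C h) T).+1 = #|C|)%N.
Proof.
case/andP=> T0 ltd; rewrite card_containing //.
have d0T : [disjoint set0 & T] by rewrite -setI_eq0 set0I.
have := @pattern_count_lt _ _ _ codeC mind set0 T d0T; rewrite cards0 add0n => <- //.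
by congr (_ * _)%N; apply: eq_card => A; rewrite !inE -setI_eq0 setI0 eqxx.
Qed.

Lemma covers_code_eq T : (0 < d)%N -> #|T| = d ->
  (2 ^ d * (covers (layer C h) T).+1)%:R =
  #|C|%:R * (1 + (-1) ^+ d * (T \in perp C)%:R) :> int.
Proof.
move=> d0 cT; rewrite card_containing ?cT //.
have d0T : [disjoint set0 & T] by rewrite -setI_eq0 set0I.
have := @pattern_count_eq _ _ _ codeC mind set0 T d0 d0T.
rewrite cards0 add0n set0U cT => <- //.
by congr (_ * _)%:R; apply: eq_card => A; rewrite !inE -setI_eq0 setI0 eqxx.
Qed.

End SingleWeight.

(** * Support designs *)

Definition supports (n : nat) (S : {set word n}) : {set {set 'I_n}} :=
  [set supp x | x in S].

Section Supports.
Local Open Scope ring_scope.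
Variable n : nat.
Implicit Types (x y : word n) (S : {set word n}) (A : {set 'I_n}).

Lemma F2_natr (a : 'F_2) : a = (a != 0)%:R.
Proof. by case: a => -[|[|m]] // lt; apply: val_inj. Qed.

Lemma natr_F2_eq0 m : (m%:R == 0 :> 'F_2) = ~~ odd m.
Proof. by rewrite -(dvdn_pcharf (pchar_Fp (isT : prime 2))) dvdn2. Qed.

Definition word_of A : word n := \row_i (i \in A)%:R.

Lemma word_ofK : cancel word_of (@supp n).
Proof.
by move=> A; apply/setP=> i; rewrite inE mxE natr_F2_eq0 negbK; case: (i \in A).
Qed.

Lemma suppK : cancel (@supp n) word_of.
Proof.
by move=> x; apply/rowP=> i; rewrite mxE inE -F2_natr.
Qed.

Lemma supp0 : supp (0 : word n) = set0.
Proof. by apply/setP=> i; rewrite !inE mxE eqxx. Qed.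

Lemma supp_ones : supp (ones n) = setT.
Proof. by apply/setP=> i; rewrite !inE mxE oner_eq0. Qed.

Lemma suppD x y : supp (x + y) = symdiff (supp x) (supp y).
Proof.
apply/setP=> i; rewrite in_symdiff !inE mxE (F2_natr (x 0 i)) (F2_natr (y 0 i)).
by rewrite -natrD !natr_F2_eq0; case: (x 0 i != 0); case: (y 0 i != 0).
Qed.

Lemma dotE x y : (\sum_(i < n) x 0 i * y 0 i == 0) = ~~ odd #|supp x :&: supp y|.
Proof.
rewrite -natr_F2_eq0 -sum1_card natr_sum [in RHS]big_mkcond; congr (_ == _).
apply: eq_bigr => i _; rewrite !inE {1}(F2_natr (x 0 i)) {1}(F2_natr (y 0 i)).
by case: (x 0 i != 0); case: (y 0 i != 0); rewrite /= ?mulr0 ?mul0r ?mulr1.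
Qed.

Lemma mem_supports S A : (A \in supports S) = (word_of A \in S).
Proof.
apply/imsetP/idP => [[x xS ->]|AS]; first by rewrite suppK.
by exists (word_of A); rewrite ?word_ofK.
Qed.

Lemma supports_dual S : supports (dual S) = perp (supports S).
Proof.
apply/setP=> A; rewrite mem_supports inE; apply/forall_inP/perpP => h x.
  rewrite mem_supports => /h; by rewrite dotE !word_ofK.
by move=> xS; rewrite dotE word_ofK h // mem_supports suppK.
Qed.

Lemma set_code_supports (C : {vspace word n}) : set_code (supports (cwords C)).
Proof.
split; first by apply/imsetP; exists 0; rewrite ?supp0 // inE mem0v.
move=> _ _ /imsetP[x + ->] /imsetP[y + ->]; rewrite !inE => xC yC.
by rewrite -suppD imset_f // inE memvD.
Qed.

Lemma supp_designE S w : supp_design S w = layer (supports S) w.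
Proof.
apply/setP=> A; apply/imsetP/layerP.
  by case=> x; rewrite inE => /andP[xS /eqP wx] ->; split=> //; rewrite imset_f.
rewrite mem_supports => -[AS cA]; exists (word_of A); rewrite ?word_ofK //.
by rewrite inE AS /wt word_ofK cA eqxx.
Qed.

Lemma occursE S w : occurs S w = [exists A in supports S, #|A| == w].
Proof.
apply/exists_inP/exists_inP => [[x xS wx]|[A]].
  by exists (supp x); rewrite ?imset_f.
by rewrite mem_supports => AS cA; exists (word_of A); rewrite // /wt word_ofK.
Qed.

Lemma nweights_uptoE S t :
  nweights_upto S t = size (weights_upto (supports S) (#|'I_n| - t)).
Proof.
rewrite card_ord /nweights_upto cardE -(size_map val); apply/perm_size/uniq_perm.
- by rewrite map_inj_uniq ?enum_uniq //; apply: val_inj.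
- by rewrite filter_uniq ?iota_uniq.
move=> u; rewrite mem_filter -occursE mem_iota add1n ltnS.
apply/mapP/idP => [[i + ->]|/andP[ou ru]].
  by rewrite mem_enum inE andbC.
have ltu : (u < n.+1)%N by case/andP: ru; lia.
by exists (Ordinal ltu); rewrite // mem_enum inE /= ru.
Qed.

Lemma minwt_le S x : x \in S -> x != 0 -> (minwt S <= wt x)%N.
Proof.
move=> xS x0; rewrite /minwt; have := mem_index_enum x.
elim: index_enum => // y r IHr; rewrite inE big_cons => /orP[/eqP <-|/IHr].
  by rewrite xS x0 geq_minl.
by case: ifP => // _ /(leq_trans _)-> //; rewrite geq_minr.
Qed.

Lemma minwt_attained S x : x \in S -> x != 0 ->
  exists y, [/\ y \in S, y != 0 & wt y = minwt S].
Proof.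
move=> xS x0.
(* The default value [n.+1] of the minimum exceeds every weight. *)
suff [E|//] : minwt S = n.+1 \/ exists y, [/\ y \in S, y != 0 & wt y = minwt S].
  have := minwt_le xS x0; rewrite E ltnNge /wt.
  by have := max_card (mem (supp x)); rewrite card_ord => ->.
rewrite /minwt.
apply: (big_rec (fun m => m = n.+1 \/ exists y, [/\ y \in S, y != 0 & wt y = m])).
  by left.
move=> y m /andP[yS y0] IHm; rewrite /minn; case: ifP => // _.
by right; exists y.
Qed.

End Supports.

(** * Strength of designs *)

Section Designs.
Variables (n : nat).
Implicit Types (B : {set {set 'I_n}}) (T : {set 'I_n}).

Lemma is_tdesignS t k B : {in B, forall Y : {set 'I_n}, #|Y| = k} ->
  is_tdesign t.+1 k B -> is_tdesign t k B.
Proof.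
move=> cB [ltk [l cl]]; split; first exact: ltnW.
(* Double counting gives (n - t) l = (k - t) lambda, and t < k makes the divisor positive. *)
exists ((n - t) * l %/ (k - t)) => T cT.
have kt : 0 < k - t by rewrite subn_gt0.
have := covers_count T cB; rewrite cT (eq_bigr (fun=> l)); last first.
  by move=> p; rewrite inE => pT; apply: cl; rewrite cardsU1 pT cT.
have -> : \sum_(p in ~: T) l = (n - t) * l.
  by rewrite sum_nat_const; congr (_ * _); have := cardsC T; rewrite card_ord cT; lia.
by move=> ->; rewrite mulKn.
Qed.

Lemma is_tdesign_leq s t k B : {in B, forall Y : {set 'I_n}, #|Y| = k} ->
  s <= t -> is_tdesign t k B -> is_tdesign s k B.
Proof.
move=> cB; elim: t => [|t IHt]; first by rewrite leqn0 => /eqP->.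
rewrite leq_eqVlt => /orP[/eqP-> //|]; rewrite ltnS => le_st.
by move/(is_tdesignS cB); apply: IHt.
Qed.

(** Strength passes down, so failure at t + 1 excludes every larger value. The occurring weight
    keeps [delta_prop] from holding vacuously. *)
Lemma delta_s_is (S : {set word n}) t :
  (exists w, 0 < w < n /\ occurs S w) ->
  (forall w, 0 < w < n -> occurs S w ->
     is_tdesign t w (layer (supports S) w) /\ ~ is_tdesign t.+1 w (layer (supports S) w)) ->
  delta_is S t /\ s_is S t.
Proof.
move=> [w0 [rw0 ow0]] dw.
have max w t' : 0 < w < n -> occurs S w -> is_tdesign t' w (supp_design S w) -> t' <= t.
  move=> rw ow; rewrite supp_designE leqNgt => h; apply/negP => ltt.
  case: (dw w rw ow) => _ []; apply: is_tdesign_leq ltt h.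
  by move=> Y /layerP[].
split; split.
- by move=> w rw ow; rewrite supp_designE; case: (dw w rw ow).
- by move=> t' /(_ w0 rw0 ow0); apply: max.
- by exists w0; rewrite supp_designE; split=> //; case: (dw w0 rw0 ow0).
- by move=> t' [w [rw ow]]; apply: max.
Qed.

End Designs.

(** * Designs from codes with one nontrivial weight *)

Section SingleWeightDesigns.
Variables (n : nat) (C : {set {set 'I_n}}) (d t h : nat) (B0 : {set 'I_n}).
Hypotheses (codeC : set_code C) (TC : setT \in C).
Hypotheses (mind : min_card (perp C) d) (B0C : B0 \in perp C) (cB0 : #|B0| = d).
Hypotheses (ltdn : d < n) (h_gt0 : 0 < h) (card_n : #|'I_n| = h.*2).
Hypothesis weight_h : {in C, forall A, A != set0 -> A != setT -> #|A| = h}.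
Hypotheses (d24 : d = 2 \/ d = 4) (dt : d = t.+1).
Implicit Types A T Y : {set 'I_n}.

Let n2h : n = h.*2.
Proof. by rewrite -card_n card_ord. Qed.

(** Words of weight h = n/2 contribute 0 to the second moment, leaving 2n^2 = |C| n. *)
Lemma card_code_four : d = 4 -> #|C| = n.*2.
Proof.
move=> d4; have d2 : 2 < d by rewrite d4.
have := second_moment codeC mind d2.
have I0 : 0 < #|'I_n| by rewrite card_ord; lia.
rewrite big_code ?codeC.1 // big1 => [|A /andP[inC /andP[A0 AT]]]; last first.
  rewrite weight_h // card_n -muln2 natrM.
  by have -> : (h%:R * 2%:R - 2 * h%:R = 0 :> int)%R by ring.
rewrite cards0 cardsT card_ord => E.
have n0 : (n%:R != 0 :> int)%R by rewrite pnatr_eq0; lia.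
apply/eqP; rewrite -(eqr_nat int) -(inj_eq (mulIf n0)) -E -muln2 natrM.
by apply/eqP; ring.
Qed.

(** |C| = 4h is a power of two, and n > 4 makes it at least 16. *)
Lemma four_dvd_half : d = 4 -> 4 %| h.
Proof.
move=> d4; have := card_set_code_dvdn codeC; rewrite card_code_four // n2h.
case/(dvdn_pfactor _ _ (isT : prime 2)) => k _.
have := ltdn; rewrite d4 n2h.
case: k => [|[|[|[|k]]]]; rewrite ?expnS ?expn0; [lia..|] => _ E.
by apply/dvdnP; exists (2 ^ k); move: E; lia.
Qed.

Lemma leq_dist_half : d <= h.
Proof.
case: d24 => d_eq; last by rewrite d_eq dvdn_leq // four_dvd_half.
by move: ltdn; rewrite n2h d_eq; lia.
Qed.

(** For d = 4 the whole set is dual because h is even, so the complement of [Y] is a nonzero dual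
    word. For d = 2 parity suffices. *)
Lemma leq_co_dist Y : Y \in perp C -> 0 < #|Y| < n -> #|Y| + d <= n.
Proof.
move=> YC rY; case: d24 => d_eq.
  by have := even_perp TC YC; have := n2h; rewrite d_eq; move: rY; lia.
have TP : setT \in perp C.
  apply/perpP=> A inC; rewrite setIT; have [->|A0] := eqVneq A set0; first by rewrite cards0.
  have [->|AT] := eqVneq A setT; first by rewrite cardsT card_n odd_double.
  rewrite weight_h // -dvdn2; exact: dvdn_trans (four_dvd_half d_eq).
have cYC := cardsC Y; rewrite card_ord in cYC.
have YCC : ~: Y \in perp C by rewrite -symdiffT; apply: (set_code_perp C).2.
have YC0 : ~: Y != set0 by rewrite -card_gt0; lia.
by have := mind YCC YC0; lia.
Qed.

Let d_even : ~~ odd d. Proof. by case: d24 => ->. Qed.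

(** [T] is made to meet [A] in the single point [a]; there is room because the complement of
    [A :\ a] has h + 1 points. *)
Lemma exists_non_dual A : A \in C -> #|A| = h ->
  exists2 T : {set 'I_n}, #|T| = d & T \notin perp C.
Proof.
move=> inC cA; have /set0Pn[a aA] : A != set0 by rewrite -card_gt0 cA.
have := cardsD1 a A; rewrite aA cA => cAa.
have := cardsC (A :\ a); rewrite card_ord => cAaC.
have dh := leq_dist_half.
have [||T [saT /subsetP sT cT]] := @exists_set_between _ [set a] (~: (A :\ a)) d.
- by rewrite sub1set !inE eqxx.
- by rewrite cards1; lia.
exists T => //; apply/perpP => /(_ A inC).
suff -> : A :&: T = [set a] by rewrite cards1.
apply/setP=> i; rewrite !inE; have [->|ia] := eqVneq i a.
  by rewrite aA (subsetP saT) ?inE.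
apply/negbTE; rewrite negb_and -implybE; apply/implyP=> iA.
by apply/negP => /sT; rewrite !inE ia iA.
Qed.

Hypothesis exists_h : exists2 A, A \in C & #|A| = h.

(** The count through a [d]-set distinguishes the dual word [B0] from a non-dual set, so the
    strength stops at t = d - 1. *)
Lemma code_tdesign : is_tdesign t h (layer C h) /\ ~ is_tdesign t.+1 h (layer C h).
Proof.
have dh := leq_dist_half.
have C0 : 0 < #|C| by apply/card_gt0P; exists set0; apply: codeC.1.
split.
  split; first by lia.
  (* |C| / 2^t words contain [T]; the predecessor discards [setT]. *)
  exists (#|C| %/ 2 ^ t).-1 => T cT.
  have rT : 0 < #|T| < d by rewrite cT; case: d24; lia.
  have := covers_code_lt codeC TC mind h_gt0 card_n weight_h rT; rewrite cT => <-.
  by rewrite mulKn ?expn_gt0.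
move=> [_ [l cl]]; have [A inC cA] := exists_h.
have [T cT TP] := exists_non_dual inC cA.
have d0 : 0 < d by rewrite dt.
have := covers_code_eq codeC TC mind h_gt0 card_n weight_h d0 cT.
have := covers_code_eq codeC TC mind h_gt0 card_n weight_h d0 cB0.
have cov Y : #|Y| = d -> covers (layer C h) Y = l by rewrite dt; apply: cl.
rewrite !cov // => -> /eqP.
rewrite B0C (negbTE TP) -signr_odd (negbTE d_even) mulr1 mulr0 addr0 mulr1.
by rewrite -[X in _ == X]mulr1 -subr_eq0 -mulrBr mulf_eq0 pnatr_eq0 eqn0Ngt C0.
Qed.

(** The same comparison of [d]-sets on the dual side; [leq_co_dist] places [w] where the
    distinguishing coefficient is nonzero. *)
Lemma perp_tdesign Y (w := #|Y|) : Y \in perp C -> 0 < w < n ->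
  is_tdesign t w (layer (perp C) w) /\ ~ is_tdesign t.+1 w (layer (perp C) w).
Proof.
move=> YC rw; have dh := leq_dist_half; have wdn := leq_co_dist YC rw.
have dw : d <= w by apply: mind => //; rewrite -card_gt0; case/andP: rw.
have [A inC cA] := exists_h.
split.
  split; first by lia.
  have [||T0 [_ _ cT0]] := @exists_set_between _ set0 B0 t.
  - exact: sub0set.
  - by rewrite cards0 cB0; lia.
  exists (covers (layer (perp C) w) T0) => T cT.
  by apply: (covers_perp_lt codeC TC mind h_gt0 card_n weight_h); rewrite cT0 ?cT //; lia.
move=> [_ [l cl]]; have [T cT TP] := exists_non_dual inC cA.
have cov (Z : {set 'I_n}) : #|Z| = d -> covers (layer (perp C) w) Z = l.
  by rewrite dt; apply: cl.
have rd : 0 < d <= h by rewrite dh andbT dt.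
have wdh : w + d <= h.*2 by rewrite -n2h.
have := covers_perp_eq codeC TC mind h_gt0 card_n weight_h rd cB0 cT B0C TP
  (even_perp TC YC) d_even dw wdh.
by rewrite !cov.
Qed.

End SingleWeightDesigns.

(** * Number of weights and admissible parameters *)

Lemma weights_one (I : finType) (C : {set {set I}}) (d t : nat) (B0 : {set I})
  (r := weights_upto C (#|I| - t)) :
  set_code C -> setT \in C -> min_card (perp C) d -> B0 \in perp C -> #|B0| = d ->
  0 < t -> d = t + size r -> size r = 1 ->
  exists h : nat, [/\ 0 < h, #|I| = h.*2,
    {in C, forall A, A != set0 -> A != setT -> #|A| = h} & exists2 A, A \in C & #|A| = h].
Proof.
move=> codeC TC mind B0C cB0 t0 eq_d r1; have r0 : 0 < size r by rewrite r1.
have in_r := mem_weights codeC TC mind B0C cB0 t0 eq_d r0.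
have [h Er] : exists h, r = [:: h] by move: r1; case: (r) => [|h []] // _; exists h.
have hr : h \in r by rewrite Er mem_head.
rewrite -/r Er in in_r; move: hr.
rewrite mem_filter mem_iota => /andP[/exists_inP[A inC /eqP cA]].
rewrite -(cardsC A) => hA.
have inCC : ~: A \in C by rewrite -symdiffT; apply: codeC.2.
exists h; split; first by lia.
(* The complement of [A] has the same weight, so the length is 2h. *)
- have : #|~: A| \in [:: h].
    apply: in_r => //; first by rewrite -card_gt0; lia.
    by rewrite -(inj_eq (@setC_inj _)) setCK setCT -card_gt0; lia.
  by rewrite inE => /eqP ->; rewrite cA addnn.
- by move=> A' inC' A0 AT; have := in_r A' inC' A0 AT; rewrite inE => /eqP.
- by exists A.
Qed.

Theorem theorem1p1 (n : nat) (C : {vspace word n}) (t : nat) :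
  let S := cwords C in
  let dp := minwt (dual S) in
  ones n \in C ->
  (exists2 y, y \in dual S & y != (0%R : word n)) ->
  (0 < t)%N ->
  dp = (t + nweights_upto S t)%N ->
  [/\ nweights_upto S t = 1%N ->
        ((dp, t) = (2, 1) \/ (dp, t) = (4, 3))%N /\
        (exists m : nat, (m = 1 \/ m = 3)%N /\
           [/\ delta_is S m, s_is S m, delta_is (dual S) m & s_is (dual S) m]),
      nweights_upto S t = 2%N -> (dp, t) = (4, 2)%N
    & nweights_upto S t = 3%N ->
        ((dp, t) = (4, 1) \/ (dp, t) = (6, 3) \/ (dp, t) = (8, 5))%N].
Proof.
move=> S d onesC [y0 y0S y00] t0; rewrite nweights_uptoE.
set Cs := supports S; set r := weights_upto Cs _ => eq_d.
have codeC : set_code Cs := set_code_supports C.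
have TC : setT \in Cs by apply/imsetP; exists (ones n); rewrite ?supp_ones // inE.
have mind : min_card (perp Cs) d.
  move=> _ /[!(esym (supports_dual S))] /imsetP[y yS ->] y1; apply: minwt_le => //.
  by apply: contraNneq y1 => ->; rewrite supp0.
have [b [bS _ cB0]] : exists b, [/\ b \in dual S, b != 0%R & #|supp b| = d] :=
  minwt_attained y0S y00.
clearbody d.
have B0C : supp b \in perp Cs by rewrite -supports_dual imset_f.
have d_even : ~~ odd d by rewrite -cB0; apply: (even_perp TC).
(* For d = t + s this gives t <= s + 2, and evenness of [d] forces t and s to have the same
   parity. *)
have le_t r0 : (t.-1).*2 <= d := leq_double_t codeC TC mind B0C cB0 t0 eq_d r0.
split=> r_eq; have r0 : 0 < size r by rewrite r_eq.
- have dt : d = t.+1 by rewrite eq_d r_eq addn1.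
  have d24 : d = 2 \/ d = 4 by move: (le_t r0) d_even; rewrite dt; lia.
  split; first by case: d24 => E; [left|right]; rewrite E; congr (_, _); lia.
  exists t; split; first by lia.
  have ltdn : d < n.
    by have := ltn_min_card TC B0C cB0 t0 eq_d r0; rewrite card_ord.
  have [h [h0 card_n weight_h ex_h]] := weights_one codeC TC mind B0C cB0 t0 eq_d r_eq.
  have n2h : n = h.*2 by rewrite -card_n card_ord.
  have [] : delta_is S t /\ s_is S t.
    apply: delta_s_is; last first.
      move=> w rw; rewrite occursE => /exists_inP[A inC /eqP cA].
      suff -> : w = h.
        exact: code_tdesign codeC TC mind B0C cB0 ltdn h0 card_n weight_h d24 dt ex_h.
      rewrite -cA weight_h // -?card_gt0 ?cA; first by case/andP: rw.
      by apply: contraTneq rw => AT; rewrite -cA AT cardsT card_ord ltnn andbF.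
    have [A inC cA] := ex_h; exists h; split; first by rewrite h0 n2h; lia.
    by rewrite occursE; apply/exists_inP; exists A; rewrite ?cA.
  have [] // : delta_is (dual S) t /\ s_is (dual S) t.
  apply: delta_s_is.
    exists d; split; first by rewrite ltdn dt.
    by rewrite occursE; apply/exists_inP; exists (supp b); rewrite ?imset_f // cB0.
  move=> w rw; rewrite occursE supports_dual => /exists_inP[Y YC /eqP cY].
  have := perp_tdesign codeC TC mind B0C cB0 ltdn h0 card_n weight_h d24 dt ex_h YC.
  by rewrite cY; apply.
- have dt : d = t + 2 by rewrite eq_d r_eq.
  have le_t4 : t <= 4 by move: (le_t r0); rewrite dt; lia.
  have [tE|tE] : t = 2 \/ t = 4.
    by move: t0 d_even le_t4; rewrite dt; case: (t) => [|[|[|[|[|]]]]] //; [left|right].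
  - by rewrite dt tE.
  - case: (not_six_four codeC TC mind B0C cB0 t0 eq_d _ tE r_eq); by rewrite dt tE.
- have dt : d = t + 3 by rewrite eq_d r_eq.
  have le_t5 : t <= 5 by move: (le_t r0); rewrite dt; lia.
  have [tE|tE|tE] : [\/ t = 1, t = 3 | t = 5].
  + move: t0 d_even le_t5; rewrite dt.
    by case: (t) => [|[|[|[|[|[|]]]]]] // _ _ _; [apply: Or31|apply: Or32|apply: Or33].
  + by left; rewrite dt tE.
  + by right; left; rewrite dt tE.
  + by right; right; rewrite dt tE.
Qed.
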